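(* Assume that the functions $\rho$ and $\gamma$ defining the kernels are non-negative. Then for any $\mu\in\mathcal{V}_d$ and $N\in\mathbb{N}$, $N\ge1$, there exists $\mu_N\in\mathcal{V}_d^N$ such that $$\|\mu_N-\mu\|_{W^*}=\min_{\nu\in\mathcal{V}_d^N}\|\nu-\mu\|_{W^*}.$$
   Context: Let $0\le d\le n$. $\widetilde{G}^n_d$ is the set of oriented $d$-dimensional linear subspaces of $\mathbb{R}^n$, identified with a subset of the unit sphere of $\Lambda^d(\mathbb{R}^n)$ by $T\mapsto \frac{u_1\wedge\cdots\wedge u_d}{|u_1\wedge\cdots\wedge u_d|}$ for any basis $(u_i)$ of $T$ consistent with its orientation, with inner product $\langle \xi_1\wedge\cdots\wedge\xi_d,\eta_1\wedge\cdots\wedge\eta_d\rangle=\det(\xi_i\cdot\eta_j)_{i,j}$. $\mathcal{V}_d$ is the set of oriented $d$-varifolds, i.e. nonnegative finite Radon measures on $\mathbb{R}^n\times\widetilde{G}^n_d$; $(\mu|\omega)=\int\omega\,d\mu$. $\mathcal{V}_d^N=\{\sum_{i=1}^N r_i\delta_{(x_i,T_i)} : r_i\ge0,\ x_i\in\mathbb{R}^n,\ T_i\in\widetilde{G}^n_d\}$. Standing kernel assumptions: $k^{pos}(x,y)=\rho(|x-y|^2)$ and $k^G(S,T)=\gamma(\langle S,T\rangle)$ are continuous positive definite kernels on $\mathbb{R}^n$ and $\widetilde{G}^n_d$ with $\rho,\gamma$ continuous, $\rho(0)>0$, and $k^{pos}(x,\cdot)\in C_0(\mathbb{R}^n)$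 for all $x$ ($C_0$: continuous functions vanishing at infinity). $W$ is the reproducing kernel Hilbert space of $k((x,T),(x',T'))=k^{pos}(x,x')k^G(T,T')$, continuously embedded in $C_0(\mathbb{R}^n\times\widetilde{G}^n_d)$; $\|\mu\|_{W^*}=\sup_{\omega\in W,\|\omega\|_W\le1}|(\mu|\omega)|$, equivalently $\|\mu\|_{W^*}^2=\iint k\,d\mu\,d\mu$. *)

(* Defs.v *)
From HB Require Import structures.
From mathcomp Require Import all_boot all_order all_algebra perm.
From mathcomp Require Import all_classical all_reals all_analysis.

Set Implicit Arguments.
Unset Strict Implicit.
Unset Printing Implicit Defensive.

Import Order.TTheory GRing.Theory Num.Theory.
Import numFieldNormedType.Exports.

Local Open Scope ring_scope.

Definition dotv (R : realType) (m : nat) (u v : 'rV[R]_m) : R :=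
  \sum_(i < m) u 0 i * v 0 i.

(* Lambda^d(R^n) is represented by coordinates in the standard orthonormal
   basis e_(f 0) /\ ... /\ e_(f (d-1)), f increasing; the inner product of
   Lambda^d(R^n) is then dotv, see dotv_wedgev. *)
Definition increasing_idx (d n : nat) (f : {ffun 'I_d -> 'I_n}) : bool :=
  [forall i : 'I_d, forall j : 'I_d, (i < j)%N ==> (f i < f j)%N].

Definition multi_index (d n : nat) : finType :=
  {f : {ffun 'I_d -> 'I_n} | increasing_idx f}.

Notation multivector R n d := 'rV[R]_#|{: multi_index d n}|.

(* The vectors u_1, ..., u_d are the rows of u. *)
Definition wedgev (R : realType) (n d : nat) (u : 'M[R]_(d, n)) :
    multivector R n d :=
  \row_(k < #|{: multi_index d n}|) \det (colsub (val (enum_val k)) u).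

Section CauchyBinet.
Variables (R : realType) (n d : nat).
Implicit Types (f g : {ffun 'I_d -> 'I_n}) (u v : 'M[R]_(d, n)).

Let fperm g (s : {perm 'I_d}) : {ffun 'I_d -> 'I_n} := [ffun i => g (s i)].

Let srt f : {ffun 'I_d -> 'I_n} :=
  [ffun i => nth (f i) (enum (f @: [set: 'I_d]%SET)) i].

Let img_fperm g s : fperm g s @: [set: 'I_d]%SET = g @: [set: 'I_d]%SET.
Proof.
apply/setP => x; apply/imsetP/imsetP => -[i _ ->].
  by exists (s i); rewrite ?inE// ffunE.
by exists (s^-1%g i); rewrite ?inE// ffunE permKV.
Qed.

Let size_img f : injective f -> size (enum (f @: [set: 'I_d]%SET)) = d.
Proof. by move=> fI; rewrite -cardE card_imset// cardsT card_ord. Qed.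

Let enum_sorted (A : {set 'I_n}) : sorted ltn (map val (enum A)).
Proof.
have -> : enum A = [seq x <- enum 'I_n | x \in A] by rewrite enumT.
have : sorted ltn (map val (enum 'I_n)) by rewrite val_enum_ord iota_ltn_sorted.
move=> h; rewrite sorted_map; apply: sorted_filter.
  by move=> a b c; exact: ltn_trans.
by move: h; rewrite sorted_map.
Qed.

Let srt_incr f : injective f -> increasing_idx (srt f).
Proof.
move=> fI; apply/forallP => i; apply/forallP => j; apply/implyP => ij.
rewrite !ffunE.
have si := size_img fI.
have := sorted_ltn_nth ltn_trans 0%N (enum_sorted (f @: [set: 'I_d]%SET)).
move=> /(_ i j); rewrite !inE size_map si !ltn_ord => /(_ isT isT ij).
move: si; move: (enum _) => s si.
rewrite (@nth_map _ (f i) _ 0%N val i s) ?si// (@nth_map _ (f i) _ 0%N val j s) ?si//.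
by rewrite (@set_nth_default _ s (f j) (f i) j) ?si.
Qed.

Let incr_inj g : increasing_idx g -> injective g.
Proof.
move=> gi i j e; apply/val_inj; move: gi => /forallP gi.
case: (ltngtP i j) => // ij.
  by have /forallP/(_ j) := gi i; rewrite ij e ltnn.
by have /forallP/(_ i) := gi j; rewrite ij e ltnn.
Qed.

Let img_srt f : injective f -> srt f @: [set: 'I_d]%SET = f @: [set: 'I_d]%SET.
Proof.
move=> fI; have si := size_img fI.
apply/eqP; rewrite eqEcard; apply/andP; split.
  apply/fintype.subsetP => x /imsetP[i _ ->]; rewrite ffunE -mem_enum.
  by rewrite mem_nth// si.
by rewrite !card_imset//; exact/incr_inj/srt_incr.
Qed.

Let incr_uniq g g' : increasing_idx g -> increasing_idx g' ->
  g @: [set: 'I_d]%SET = g' @: [set: 'I_d]%SET -> g = g'.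
Proof.
have codom_sorted h : increasing_idx h ->
    sorted ltn [seq val (h i) | i <- enum 'I_d].
  move=> hi; rewrite (map_comp val h) 2!sorted_map.
  apply: (@sub_sorted _ (relpre val ltn)); last first.
    by rewrite -sorted_map val_enum_ord iota_ltn_sorted.
  by move=> i j /= ij; move: hi => /forallP/(_ i)/forallP/(_ j)/implyP; apply.
move=> gi gi' e; apply/ffunP => i; apply/val_inj.
suff : [seq val (g i) | i <- enum 'I_d] = [seq val (g' i) | i <- enum 'I_d].
  by move=> /eq_in_map; apply; rewrite mem_enum.
apply: (irr_sorted_eq ltn_trans ltnn); rewrite ?codom_sorted//.
have mem h x : (x \in [seq val (h i) | i <- enum 'I_d]) =
    [exists y in h @: [set: 'I_d]%SET, val y == x].
  apply/mapP/existsP => [[j _ ->]|[y /andP[/imsetP[j _ ->] /eqP <-]]].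
    by exists (h j); rewrite imset_f ?inE /=.
  by exists j; rewrite ?mem_enum.
by move=> x; rewrite !mem e.
Qed.

Let fiberE g : increasing_idx g ->
  [set f : {ffun _} | injectiveb f && (srt f == g)]%SET = [set fperm g s | s in {perm 'I_d}]%SET.
Proof.
move=> gi; apply/setP => f; rewrite inE; apply/andP/imsetP.
  move=> [/injectiveP fI /eqP sfg].
  have /fin_all_exists[s sE] i : exists j, g j = f i.
    have : f i \in f @: [set: 'I_d]%SET by rewrite imset_f.
    by rewrite -(img_srt fI) sfg => /imsetP[j _ ->]; exists j.
  have sI : injective s by move=> i j e; apply: fI; rewrite -!sE e.
  by exists (perm sI) => //; apply/ffunP => i; rewrite ffunE permE sE.
move=> [s _ ->].
have fI : injective (fperm g s).
  by move=> i j; rewrite !ffunE => /(incr_inj gi) /perm_inj.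
split; first exact/injectiveP.
apply/eqP/incr_uniq => //; first exact: srt_incr.
by rewrite img_srt// img_fperm.
Qed.

Let detT_expand u v : \det (u *m v^T) =
  \sum_(f : {ffun 'I_d -> 'I_n}) (\prod_i u i (f i)) * \det (colsub f v).
Proof.
rewrite /determinant.
under eq_bigr => s _.
  under eq_bigr => i _ do rewrite mxE.
  rewrite bigA_distr_bigA big_distrr /=; over.
rewrite exchange_big /=; apply: eq_bigr => f _.
rewrite -/(determinant _) -det_tr /determinant big_distrr /=.
apply: eq_bigr => s _; rewrite mulrCA; congr (_ * _).
by rewrite big_split /=; congr (_ * _); apply: eq_bigr => i _; rewrite !mxE.
Qed.

Lemma dotv_wedgev u v : dotv (wedgev u) (wedgev v) = \det (u *m v^T).
Proof.
rewrite detT_expand (bigID (fun f : {ffun 'I_d -> 'I_n} => injectiveb f)) /=.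
rewrite [X in _ = _ + X]big1 ?addr0; last first.
  move=> f /injectivePn[i [j ij fij]].
  rewrite -det_tr (determinant_alternate ij) ?mulr0// => k.
  by rewrite !mxE fij.
rewrite (partition_big srt (@increasing_idx d n)) /=; last first.
  by move=> f /injectiveP; exact: srt_incr.
pose F g := \det (colsub g u) * \det (colsub g v).
have -> : dotv (wedgev u) (wedgev v) = \sum_(g : multi_index d n) F (val g).
  rewrite /dotv [RHS](reindex (@enum_val _ {: multi_index d n})) /=.
    by apply: eq_bigr => k _; rewrite !mxE.
  by apply: onW_bij; exact: enum_val_bij.
have -> : \sum_(g : multi_index d n) F (val g) =
    \sum_(g | increasing_idx g) F g.
  rewrite (reindex_omap (val : multi_index d n -> _) insub) /=; last first.
    by move=> g gi; rewrite insubT.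
  by apply: eq_bigl => g; rewrite valK eqxx andbT (valP g).
apply: eq_bigr => g gi.
rewrite -big_set fiberE// big_imset /=; last first.
  move=> s t _ _ /ffunP e; apply/permP => i.
  by have := e i; rewrite !ffunE; exact: incr_inj.
rewrite /F {1}/determinant big_distrl /=; apply: eq_bigr => s _.
have -> : colsub (fperm g s) v = col_perm s (colsub g v).
  by apply/matrixP => i j; rewrite !mxE ffunE.
rewrite col_permE det_mulmx det_perm odd_permV -mulrA mulrC mulrA.
by do 2 congr (_ * _); apply: eq_bigr => i _; rewrite !mxE ffunE.
Qed.

End CauchyBinet.

Local Open Scope classical_set_scope.

(* Bases of T that induce the same orientation have the same normalized wedge.
   For d = 0 the only basis is empty, so the set is {1}. *)
Definition oriented_grassmannian (R : realType) (n d : nat) :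
    set (multivector R n d) :=
  [set xi | exists2 u : 'M[R]_(d, n), row_free u &
    xi = (Num.sqrt (dotv (wedgev u) (wedgev u)))^-1 *: wedgev u].

(* The inequality d <= n makes the type inhabited, as the library requires of
   a measurable space. *)
Definition ograss (R : realType) (n d : nat) (hdn : (d <= n)%N) : Type :=
  set_type (@oriented_grassmannian R n d).

Section ograss_structures.
Variables (R : realType) (n d : nat) (hdn : (d <= n)%N).

Lemma ograss_nonempty :
  {xi | xi \in @oriented_grassmannian R n d}.
Proof.
exists ((Num.sqrt (dotv (wedgev (pid_mx d : 'M[R]_(d, n)))
  (wedgev (pid_mx d : 'M[R]_(d, n)))))^-1 *: wedgev (pid_mx d : 'M[R]_(d, n))).
apply/mem_set; exists (pid_mx d) => //.
by rewrite /row_free rank_pid_mx ?leqnn.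
Qed.

HB.instance Definition _ :=
  PseudoMetric.copy (ograss R hdn) (set_type (@oriented_grassmannian R n d)).
HB.instance Definition _ := isPointed.Build (ograss R hdn)
  (exist _ (sval ograss_nonempty) (svalP ograss_nonempty)).

End ograss_structures.

Lemma dotv_ge0 (R : realType) (m : nat) (u : 'rV[R]_m) : 0 <= dotv u u.
Proof. by apply: sumr_ge0 => i _; rewrite -expr2 sqr_ge0. Qed.

Lemma dotv_eq0 (R : realType) (m : nat) (u : 'rV[R]_m) : dotv u u = 0 -> u = 0.
Proof.
move=> /eqP; rewrite /dotv psumr_eq0 => [/allP u0|i _]; last first.
  by rewrite -expr2 sqr_ge0.
apply/rowP => i; rewrite mxE; apply/eqP; rewrite -sqrf_eq0 expr2.
by apply: u0; rewrite mem_index_enum.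
Qed.

Lemma wedgev_neq0 (R : realType) (n d : nat) (u : 'M[R]_(d, n)) :
  row_free u -> dotv (wedgev u) (wedgev u) != 0.
Proof.
move=> uf; rewrite dotv_wedgev; apply/negP => /det0P[x /negP x0 xuu]; apply: x0.
rewrite -(mulmx_free_eq0 _ uf); apply/eqP/dotv_eq0.
have : (x *m (u *m u^T) *m x^T) 0 0 = 0 by rewrite xuu mul0mx mxE.
rewrite mulmxA -mulmxA -trmx_mul mxE => xu0; rewrite -[RHS]xu0.
by apply: eq_bigr => i _; rewrite [X in _ = _ * X]mxE.
Qed.

Lemma ograss_unit (R : realType) (n d : nat) (hdn : (d <= n)%N)
  (T : ograss R hdn) : dotv (set_val T) (set_val T) = 1.
Proof.
have [u uf Tu] := set_mem (svalP T); rewrite -[set_val T]/(sval T) Tu.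
set w := wedgev u; have w0 : 0 < dotv w w.
  by rewrite lt_neqAle eq_sym wedgev_neq0// dotv_ge0.
set c := (Num.sqrt _)^-1.
have -> : dotv (c *: w) (c *: w) = c ^+ 2 * dotv w w.
  by rewrite /dotv mulr_sumr; apply: eq_bigr => i _; rewrite !mxE mulrACA.
by rewrite /c exprVn sqr_sqrtr ?(ltW w0)// mulVf ?gt_eqF.
Qed.

Section varifolds.
Variables (R : realType) (n d : nat) (hdn : (d <= n)%N).

Definition varifold_base : Type := ('rV[R]_n * ograss R hdn)%type.

Definition borel_base :=
  g_sigma_algebraType (@open (varifold_base : topologicalType)).

(* Nonnegative finite Borel measures are bundled in {finite_measure ..}; what
   remains of "Radon" is inner regularity by compact sets. *)
Definition radon (mu : {finite_measure set borel_base -> \bar R}) : Prop :=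
  forall A : set borel_base, measurable A ->
    mu A = ereal_sup [set mu K | K in
      [set K : set borel_base | compact (K : set varifold_base) /\ K `<=` A]].

Definition varifold : set {finite_measure set borel_base -> \bar R} :=
  [set mu | radon mu].

Definition discrete_varifold (N : nat) :
    set {finite_measure set borel_base -> \bar R} :=
  fun mu => exists (r : 'I_N -> R) (x : 'I_N -> 'rV[R]_n)
                   (T : 'I_N -> ograss R hdn),
    (forall i, 0 <= r i) /\
    (forall A : set borel_base, measurable A ->
      mu A = \sum_(i < N) ((r i)%:E * \d_((x i, T i) : borel_base) A))%E.

End varifolds.

Definition positive_definite_kernel (R : realType) (X : Type)
    (k : X -> X -> R) : Prop :=
  (forall x y, k x y = k y x) /\
  forall (m : nat) (x : 'I_m -> X) (c : 'I_m -> R),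
    0 <= \sum_(i < m) \sum_(j < m) c i * c j * k (x i) (x j).

Definition continuous_kernel (R : realType) (X : topologicalType)
    (k : X -> X -> R) : Prop :=
  continuous (fun p : X * X => k p.1 p.2).

Definition C0 (R : realType) (X : topologicalType) : set (X -> R) :=
  [set f | continuous f /\
    forall e : R, 0 < e ->
      exists2 K : set X, compact K & forall x, ~ K x -> `|f x| < e].

Definition kpos (R : realType) (n : nat) (rho : R -> R) (x y : 'rV[R]_n) : R :=
  rho (dotv (x - y) (x - y)).

Definition kG (R : realType) (n d : nat) (hdn : (d <= n)%N) (gamma : R -> R)
    (S T : ograss R hdn) : R :=
  gamma (dotv (set_val S) (set_val T)).

Definition varifold_kernel (R : realType) (n d : nat) (hdn : (d <= n)%N)
    (rho gamma : R -> R) (z w : varifold_base R hdn) : R :=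
  kpos rho z.1 w.1 * kG gamma z.2 w.2.

(* A Hilbert space of functions on X, realized by the injective evaluation map
   rkhs_fun, whose reproducing kernel is k. It is determined by k up to a unique
   isometry compatible with rkhs_fun. *)
Record rkhs (R : realType) (X : Type) (k : X -> X -> R) := Rkhs {
  rkhs_space :> completeNormedModType R ;
  rkhs_dot : {dot rkhs_space for idfun} ;
  rkhs_norm : forall w, `|w| ^+ 2 = rkhs_dot w w ;
  rkhs_fun : {linear rkhs_space -> (X -> R)} ;
  rkhs_fun_inj : injective rkhs_fun ;
  rkhs_repr : X -> rkhs_space ;
  rkhs_reprE : forall x, rkhs_fun (rkhs_repr x) = k x ;
  rkhs_reproducing : forall w x, rkhs_fun w x = rkhs_dot w (rkhs_repr x)
}.

(* The norm of W^* on linear functionals, with values in [0, +oo]. *)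
Definition dual_norm (R : realType) (X : Type) (k : X -> X -> R) (W : rkhs k)
    (L : W -> R) : \bar R :=
  ereal_sup [set `|L w|%:E | w in [set w : W | `|w| <= 1]].

(* (mu | w) *)
Definition pairing (R : realType) (n d : nat) (hdn : (d <= n)%N)
    (k : varifold_base R hdn -> varifold_base R hdn -> R) (W : rkhs k)
    (mu : {finite_measure set (borel_base R hdn) -> \bar R}) (w : W) : R :=
  \int[mu]_z rkhs_fun W w z.

(* Main.v *)
(* Along a minimizing family of configurations [(r_i, z_i)] the weights stay
   bounded: the kernel is nonnegative, so no cancellation can occur, and testing
   against the normalized kernel section at [z_i] bounds [r_i]. Passing to an
   ultrafilter, each weight converges and each point either converges or leaves
   every compact set; in the second case its contribution tends to zero against
   every element of [W], because [W] consists of functions vanishing at infinity.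
   Here compactness of the oriented Grassmannian, the image of the orthonormal
   frames under the wedge map, is used. The limit configuration (with weight zero
   on the lost points) is a minimizer because the dual norm is a supremum of
   functionals that converge along the ultrafilter. *)

Require Import Defs.
From mathcomp Require Import all_boot all_order all_algebra.
From mathcomp Require Import all_classical all_reals all_analysis.
From mathcomp Require Import measurable_realfun ring lra.
From HB Require Import structures.

Import Order.TTheory GRing.Theory Num.Theory.
Import numFieldNormedType.Exports.

Local Open Scope classical_set_scope.
Local Open Scope ring_scope.

(** * Norm, inner product and evaluation in a reproducing kernel Hilbert space *)

Section rkhs_theory.
Context {R : realType} {X : Type} {k : X -> X -> R} (W : rkhs k).
Local Notation dot := (@rkhs_dot R X k W).
Local Notation phi := (@rkhs_repr R X k W).
Local Notation ev := (@rkhs_fun R X k W).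

Lemma rkhs_dotC (u v : W) : dot u v = dot v u.
Proof. by rewrite hermC expr0 mul1r. Qed.

Lemma rkhs_dotZr (a : R) (u v : W) : dot u (a *: v) = a * dot u v.
Proof. exact: (linearZr_LR dot). Qed.

Lemma rkhs_dotZl (a : R) (u v : W) : dot (a *: u) v = a * dot u v.
Proof. exact: (linearZl_LR dot). Qed.

Lemma rkhs_normD (u v : W) :
  `|u + v| ^+ 2 = `|u| ^+ 2 + `|v| ^+ 2 + 2 * dot u v.
Proof.
rewrite !rkhs_norm linearDl /= !linearDr /= (rkhs_dotC v u).
by rewrite -!addrA; congr (_ + _); rewrite mulr_natl mulr2n [RHS]addrC -!addrA.
Qed.

Lemma rkhs_normZ (a : R) (u : W) : `|a *: u| ^+ 2 = a ^+ 2 * `|u| ^+ 2.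
Proof. by rewrite normrZ exprMn real_normK ?num_real. Qed.

Lemma rkhs_CauchySchwarz (u v : W) : `|dot u v| <= `|u| * `|v|.
Proof.
have [->|v0] := eqVneq v 0; first by rewrite linear0r !normr0 mulr0.
have v2 : 0 < `|v| ^+ 2 by rewrite exprn_gt0// normr_gt0.
(* The vector is the component of [u] orthogonal to [v]. *)
have := sqr_ge0 `|u + - (dot u v / `|v| ^+ 2) *: v|.
rewrite rkhs_normD rkhs_normZ rkhs_dotZr.
have -> : `|u| ^+ 2 + (- (dot u v / `|v| ^+ 2)) ^+ 2 * `|v| ^+ 2 +
    2 * (- (dot u v / `|v| ^+ 2) * dot u v) =
    (`|u| ^+ 2 * `|v| ^+ 2 - dot u v ^+ 2) / `|v| ^+ 2 by field; rewrite normr_eq0.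
rewrite pmulr_lge0 ?invr_gt0// subr_ge0 -exprMn => h.
by rewrite -ler_sqr ?nnegrE ?mulr_ge0// real_normK ?num_real.
Qed.

Lemma rkhs_dot_repr (x y : X) : dot (phi x) (phi y) = k x y.
Proof. by rewrite -rkhs_reproducing rkhs_reprE. Qed.

Lemma rkhs_norm_repr (x : X) : `|phi x| ^+ 2 = k x x.
Proof. by rewrite rkhs_norm rkhs_dot_repr. Qed.

Lemma rkhs_kernel_diag_ge0 (x : X) : 0 <= k x x.
Proof. by rewrite -rkhs_norm_repr sqr_ge0. Qed.

Lemma rkhs_fun_le (w : W) (x : X) : `|ev w x| <= `|w| * Num.sqrt (k x x).
Proof.
rewrite rkhs_reproducing (le_trans (rkhs_CauchySchwarz _ _))//.
by rewrite -rkhs_norm_repr sqrtr_sqr normr_id.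
Qed.

End rkhs_theory.

(** * Functions of the Hilbert space lie in [C0] *)

Section rkhs_C0.
Context {R : realType} {X : topologicalType} {k : X -> X -> R} (W : rkhs k).
Variable C : R.
Hypothesis kC : forall x, k x x = C.
Hypothesis k_C0 : forall x, @C0 R X (k x).
Local Notation dot := (@rkhs_dot R X k W).
Local Notation phi := (@rkhs_repr R X k W).
Local Notation ev := (@rkhs_fun R X k W).

(** Since the diagonal is constant, [|phi x - phi y| ^+ 2 = 2 * (C - k x y)], so continuity of the
    single section [k x] at [x] makes [phi] continuous there; Cauchy-Schwarz transfers this to
    [ev w]. *)
Lemma rkhs_fun_continuous (w : W) : continuous (ev w).
Proof.
move=> x; apply/cvgrPdist_lt => /= e e0.
have [kx _] := k_C0 x.
(* The [+ 1] keeps the denominator positive when [w = 0]. *)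
have d0 : 0 < e ^+ 2 / (2 * (`|w| ^+ 2 + 1)).
  by rewrite divr_gt0 ?exprn_gt0// mulr_gt0// ltr_wpDl ?sqr_ge0.
have /cvgrPdist_lt/(_ _ d0) := kx x.
apply: filterS => y; rewrite kC => xy.
rewrite !rkhs_reproducing -linearBr /=.
apply: le_lt_trans (rkhs_CauchySchwarz _ _ _) _.
rewrite -ltr_sqr ?nnegrE ?mulr_ge0 ?(ltW e0)// exprMn.
have -> : `|phi x - phi y| ^+ 2 = 2 * (C - k x y).
  have := rkhs_normD W (phi x) (- phi y).
  rewrite normrN !rkhs_norm_repr !kC linearNr /= rkhs_dot_repr => ->.
  by ring.
have {}xy : C - k x y < e ^+ 2 / (2 * (`|w| ^+ 2 + 1)).
  by apply: le_lt_trans xy; exact: ler_norm.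
have w1 : 0 < `|w| ^+ 2 + 1 by rewrite ltr_wpDl ?sqr_ge0.
apply: (@le_lt_trans _ _ (`|w| ^+ 2 * (e ^+ 2 / (`|w| ^+ 2 + 1)))).
  rewrite ler_wpM2l ?sqr_ge0// -ler_pdivlMl// mulrC.
  by apply/ltW/(lt_le_trans xy); rewrite invfM; lra.
by rewrite mulrA ltr_pdivrMr// mulrC ltr_pM2l ?exprn_gt0//; lra.
Qed.

(* If [|ev w|] were at least [e] outside every compact set, one could pick
   points far apart, making the [phi]'s almost orthogonal: the signed sum of [m]
   of them has norm of order [sqrt m] but pairs with [w] to at least [m * e]. *)
Lemma rkhs_fun_vanish (w : W) (e : R) : 0 < e ->
  exists2 K : set X, compact K & forall x, ~ K x -> `|ev w x| < e.
Proof.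
move=> e0; apply: contrapT => noK.
have far (K : set X) : compact K -> exists2 x, ~ K x & e <= `|ev w x|.
  move=> cK; apply: contrapT => nox; apply: noK; exists K => // x Kx.
  by rewrite ltNge; apply/negP => ex; apply: nox; exists x.
(* The first clause carries the induction: it provides a compact set outside which [ev v] is small,
   and the next point is taken there. *)
have sums (m : nat) : exists v : W, [/\
    forall d, 0 < d -> exists2 K : set X, compact K &
      forall x, ~ K x -> `|ev v x| < d,
    m%:R * e <= dot w v & `|v| ^+ 2 <= m%:R * (C + 1)].
  elim: m => [|m [v [v0 wv vv]]].
    exists 0; split.
    - move=> d d0; exists set0; first exact: compact0.
      by move=> x _; rewrite rkhs_reproducing linear0l normr0.
    - by rewrite mul0r linear0r.
    - by rewrite mul0r normr0 expr0n.
  (* With [|ev v x|] below 1/2 the cross term of the squared norm stays below 1, whence [C + 1] per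
     added point. *)
  have h0 : 0 < 2^-1 :> R by rewrite invr_gt0.
  have [K cK Kv] := v0 _ h0.
  have [x Kx ex] := far K cK.
  pose s := Num.sg (ev w x).
  have s1 : s ^+ 2 = 1.
    rewrite /s sqr_sg; case: eqP => // w0.
    by move: ex; rewrite w0 normr0 leNgt e0.
  exists (v + s *: phi x); split.
  - move=> d d0; have d2 : 0 < d / 2 by rewrite divr_gt0.
    have [K1 cK1 K1v] := v0 _ d2.
    have [_ /(_ _ d2)[K2 cK2 K2x]] := k_C0 x.
    exists (K1 `|` K2); first exact: compactU.
    move=> y /not_orP[/K1v y1 /K2x y2].
    rewrite rkhs_reproducing linearDl /= rkhs_dotZl rkhs_dot_repr.
    rewrite -rkhs_reproducing (le_lt_trans (ler_normD _ _))//.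
    rewrite normrM (_ : `|s| = 1) ?mul1r; last first.
      by apply/eqP; rewrite -(@eqrXn2 _ 2)// real_normK ?num_real// s1 expr1n.
    by rewrite [ltRHS](splitr d) ltrD.
  - rewrite linearDr /= rkhs_dotZr -rkhs_reproducing -normrEsg.
    by rewrite -natr1 mulrDl mul1r lerD.
  - rewrite rkhs_normD rkhs_normZ s1 mul1r rkhs_norm_repr kC rkhs_dotZr.
    rewrite -rkhs_reproducing.
    have : `|s * ev v x| < 2^-1.
      rewrite normrM (_ : `|s| = 1) ?mul1r ?Kv//.
      by apply/eqP; rewrite -(@eqrXn2 _ 2)// real_normK ?num_real// s1 expr1n.
    move/ltr_normlW => sv.
    rewrite -natr1 mulrDl mul1r; lra.
(* [X] may be empty a priori; [far] applied to the empty set supplies a point, and with it the sign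
   of [C]. *)
have [x0 _ _] := far set0 (@compact0 _).
have C0 : 0 <= C by rewrite -(kC x0) (rkhs_kernel_diag_ge0 W).
(* For such [m], [(m * e) ^+ 2] exceeds [m * (C + 1) * |w| ^+ 2], against Cauchy-Schwarz for [w] and
   [v]. *)
have [m] : exists m : nat, `|w| ^+ 2 * (C + 1) / e ^+ 2 < m%:R.
  exists (Num.bound (`|w| ^+ 2 * (C + 1) / e ^+ 2)).
  by apply/archi_boundP; rewrite divr_ge0 ?sqr_ge0// mulr_ge0 ?sqr_ge0// addr_ge0.
rewrite ltr_pdivrMr ?exprn_gt0// => wm.
have [v [_ wv vv]] := sums m.
have m0 : 0 < m%:R :> R.
  rewrite ltr0n lt0n; apply/eqP => m0; move: wm; rewrite m0 mul0r ltNge.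
  by rewrite mulr_ge0 ?sqr_ge0// addr_ge0.
have : (m%:R * e) ^+ 2 <= `|w| ^+ 2 * `|v| ^+ 2.
  rewrite -exprMn ler_sqr ?nnegrE ?mulr_ge0 ?(ltW e0)//.
  by rewrite (le_trans wv)// (le_trans (ler_norm _))// rkhs_CauchySchwarz.
apply/negP; rewrite -ltNge.
apply: (@le_lt_trans _ _ (m%:R * (`|w| ^+ 2 * (C + 1)))).
  by rewrite [leRHS]mulrCA ler_wpM2l ?sqr_ge0.
by rewrite exprMn [m%:R ^+ 2]expr2 -mulrA ltr_pM2l.
Qed.

Lemma rkhs_fun_C0 (w : W) : @C0 R X (ev w).
Proof. by split; [exact: rkhs_fun_continuous | exact: rkhs_fun_vanish]. Qed.

End rkhs_C0.

(** * Limits along ultrafilters *)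

Section ultra_limits.

(** Maximality: if a larger proper filter contained [A] while [F] omitted the preimage of [A], then
    [F] would contain the complement of that preimage, and the larger filter both [A] and its
    complement. *)
Lemma ultra_fmap {T U : Type} (f : T -> U) {F : set_system T} :
  UltraFilter F -> UltraFilter (f @ F).
Proof.
move=> FU; split; first exact: fmap_proper_filter.
move=> G PG FG; apply/seteqP; split; last exact: FG.
move=> A GA; have [//|FnA] := in_ultra_setVsetC (f @^-1` A) FU.
have GnA : G (~` A) by apply: FG.
by have /filter_ex[x []] : G (A `&` ~` A) by exact: filterI.
Qed.

Lemma ultra_compact_cvg {T : Type} {X : topologicalType} {f : T -> X}
    {F : set_system T} {K : set X} :
  UltraFilter F -> compact K -> (\forall t \near F, K (f t)) ->
  exists2 x, K x & f @ F --> x.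
Proof.
move=> FU cK FK.
have := cK; rewrite compact_ultra => /(_ _ (ultra_fmap _ FU) FK)[x [Kx Fx]].
by exists x.
Qed.

(* Either [f @ F] contains a compact set, hence converges, or it contains the
   complement of every compact set. *)
Lemma ultra_C0_cvg (R : realType) {T : Type} {X : topologicalType} (f : T -> X)
    {F : set_system T} : UltraFilter F ->
  (exists x, forall g : X -> R, C0 g -> g (f t) @[t --> F] --> g x) \/
  (forall g : X -> R, C0 g -> g (f t) @[t --> F] --> 0).
Proof.
move=> FU.
have [[K cK FK]|noK] := pselect (exists2 K, compact K & \forall t \near F, K (f t)).
  left; have [x _ fx] := ultra_compact_cvg FU cK FK.
  by exists x => g [gc _]; apply: continuous_cvg => //; exact: gc.
right=> g [_ g0]; apply/cvgr0Pnorm_lt => e /g0[K cK Ke].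
have [FK|] := in_ultra_setVsetC [set t | K (f t)] FU.
  by exfalso; apply: noK; exists K.
by apply: filterS => t /Ke.
Qed.

End ultra_limits.

(** * Existence of a minimizing configuration of weights and points *)

Section best_approximation.
Context {R : realType} {X : topologicalType} {k : X -> X -> R} (W : rkhs k).
Variables (x0 : X) (C B : R) (L : W -> R) (N : nat).
Hypothesis C_gt0 : 0 < C.
Hypothesis kC : forall x, k x x = C.
Hypothesis k_ge0 : forall x y, 0 <= k x y.
Hypothesis k_C0 : forall x, @C0 R X (k x).
Hypothesis LB : forall w, `|w| <= 1 -> `|L w| <= B.
Local Notation phi := (@rkhs_repr R X k W).
Local Notation ev := (@rkhs_fun R X k W).

Let comb (c : ('I_N -> R) * ('I_N -> X)) (w : W) : R :=
  \sum_(i < N) c.1 i * ev w (c.2 i).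

Let D c := dual_norm (fun w => comb c w - L w).

Let LB_le_D c w : `|w| <= 1 -> (`|comb c w - L w|%:E <= D c)%E.
Proof. by move=> w1; apply: ereal_sup_ubound; exists w. Qed.

(* Tested against the normalized kernel section at [c.2 i]: no cancellation can
   occur since the kernel is nonnegative. *)
Let weight_bound c (s : R) : (forall i, 0 <= c.1 i) -> (D c <= s%:E)%E ->
  forall i, c.1 i <= (s + B) / Num.sqrt C.
Proof.
move=> c0 Ds i.
have sC : 0 < Num.sqrt C by rewrite sqrtr_gt0.
pose w := (Num.sqrt C)^-1 *: phi (c.2 i).
have w1 : `|w| = 1.
  apply/eqP; rewrite -(@eqrXn2 _ 2)// rkhs_normZ rkhs_norm_repr kC.
  by rewrite exprVn sqr_sqrtr ?ltW// mulVf ?expr1n// gt_eqF.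
have := LB_le_D c w; rewrite w1 lexx => /(_ isT) /le_trans /(_ Ds).
rewrite lee_fin => cLs.
have wi : c.1 i * Num.sqrt C <= comb c w.
  rewrite /comb (bigD1 i)//= rkhs_reproducing rkhs_dotZl rkhs_dot_repr kC.
  rewrite -{3}(sqr_sqrtr (ltW C_gt0)) expr2 mulKf ?gt_eqF// lerDl.
  apply: sumr_ge0 => j _; rewrite rkhs_reproducing rkhs_dotZl rkhs_dot_repr.
  by rewrite mulr_ge0// mulr_ge0// invr_ge0 ltW.
rewrite ler_pdivlMr// (le_trans wi)//.
have := ler_norm (comb c w - L w).
by have := LB w; rewrite w1 lexx => /(_ isT); move/ler_normlP => [_]; lra.
Qed.

(** The competitor that bounds the infimum from above by [B]; its points are irrelevant because its
    weights vanish. *)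
Let zero_config : ('I_N -> R) * ('I_N -> X) := (cst 0, cst x0).

Let D_zero : (D zero_config <= B%:E)%E.
Proof.
apply: ge_ereal_sup => _ [w /= w1 <-]; rewrite lee_fin /comb big1.
  by rewrite sub0r normrN LB.
by move=> i _; rewrite /= mul0r.
Qed.

Let admissible : set (('I_N -> R) * ('I_N -> X)) :=
  [set c | forall i, 0 <= c.1 i].

Let s := ereal_inf (D @` admissible).

Let s_fin : s \is a fin_num.
Proof.
rewrite fin_real//; apply/andP; split.
  apply: (@lt_le_trans _ _ 0%E); first exact: ltNy0.
  apply: le_ereal_inf_tmp => _ [c _ <-].
  apply: (@le_trans _ _ `|comb c 0 - L 0|%:E); first by rewrite lee_fin.
  by apply: LB_le_D; rewrite normr0.
apply: (@le_lt_trans _ _ B%:E); last exact: ltry.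
by apply: le_trans D_zero; apply: ereal_inf_lbound; exists zero_config.
Qed.

Let near_minimizers (e : R) : set (('I_N -> R) * ('I_N -> X)) :=
  [set c | admissible c /\ (D c <= s + e%:E)%E].

(** A filter takes the place of a minimizing sequence, so that an ultrafilter refining it gives all
    limits at once. *)
Let minimizing : set_system (('I_N -> R) * ('I_N -> X)) :=
  filter_from [set e : R | 0 < e] near_minimizers.

Let minimizing_proper : ProperFilter minimizing.
Proof.
apply: filter_from_proper; last first.
  move=> e /= e0.
  have [_ [c ac <-] /ltW cs] := lb_ereal_inf_adherent e0 s_fin.
  by exists c.
apply: filter_from_filter; first by exists 1; exact: ltr01.
move=> e1 e2 /= e10 e20; exists (Num.min e1 e2) => /=; first by rewrite lt_min e10.
move=> c [ac cs]; split; split => //; apply: (le_trans cs).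
  by rewrite leeD2l// lee_fin ge_min lexx.
by rewrite leeD2l// lee_fin ge_min lexx orbT.
Qed.

(** [L] stands for the pairing with the target measure, and measures are replaced by their weights
    and points. *)
Lemma best_approximation : exists r : 'I_N -> R, exists x : 'I_N -> X,
  (forall i, 0 <= r i) /\
  forall (r' : 'I_N -> R) (x' : 'I_N -> X), (forall i, 0 <= r' i) ->
    (dual_norm (fun w : W => (\sum_(i < N) r i * ev w (x i) - L w)%R) <=
     dual_norm (fun w : W => (\sum_(i < N) r' i * ev w (x' i) - L w)%R))%E.
Proof.
have [F [FU sF]] := ultraFilterLemma minimizing_proper.
have lim_weight i : exists2 a : R, 0 <= a & c.1 i @[c --> F] --> a.
  (* Configurations within 1 of the infimum already have weights in a fixed segment. *)
  have FI : \forall c \near F, c.1 i \in `[0, (fine s + 1 + B) / Num.sqrt C].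
    apply: sF; exists 1 => //= c [ac cs]; rewrite in_itv /= ac /=.
    by apply: weight_bound => //; rewrite !EFinD fineK.
  have [a] := @ultra_compact_cvg _ R _ _ _ FU (@segment_compact _ _ _) FI.
  by rewrite /= in_itv /= => /andP[a0 _] ca; exists a.
have lim_term i : exists p : R * X, 0 <= p.1 /\ forall w,
    c.1 i * ev w (c.2 i) @[c --> F] --> p.1 * ev w p.2.
  have [a a0 ca] := lim_weight i.
  have [[x cx]|cx] := @ultra_C0_cvg R _ X (fun c => c.2 i) _ FU.
    exists (a, x); split => // w; apply: cvgM => //.
    by apply: cx; exact: rkhs_fun_C0.
  (* The point escapes to infinity: the term tends to [a * 0], which equals [0 * ev w x0] for the
     placeholder [x0]. *)
  exists (0, x0); split => // w; rewrite mul0r -(mulr0 a); apply: cvgM => //.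
  by apply: cx; exact: rkhs_fun_C0.
have [p pP] := choice lim_term.
exists (fun i => (p i).1), (fun i => (p i).2).
split=> [i|r' x' r'0]; first by have [] := pP i.
apply: (@le_trans _ _ s); last first.
  by apply: ereal_inf_lbound; exists (r', x').
apply: ge_ereal_sup => _ [w /= w1 <-].
(* For fixed [w], the bound [|comb c w - L w| <= D c <= s + e] holds eventually along [F] and passes
   to the limit. *)
rewrite -(fineK s_fin) lee_fin; apply/ler_addgt0Pr => e e0.
have cvg_w : `|comb c w - L w| @[c --> F] -->
    `|\sum_(i < N) (p i).1 * ev w (p i).2 - L w|.
  apply: cvg_norm; apply: cvgB; last exact: cvg_cst.
  by apply: cvg_big => [|i _]; [exact: add_continuous|have [_] := pP i].
apply: (cvgr_to_le cvg_w).
apply: sF; exists e => //= c [_ cs].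
by rewrite -lee_fin EFinD fineK// (le_trans _ cs)// LB_le_D.
Qed.

End best_approximation.

(** * Compactness of the oriented Grassmannian *)

Section grassmannian_compact.
Context {R : realType}.

Lemma dotvE (m : nat) (u v : 'rV[R]_m) : dotv u v = (u *m v^T) 0 0.
Proof. by rewrite mxE; apply: eq_bigr => i _; rewrite mxE. Qed.

Lemma dotvZ (m : nat) (a b : R) (u v : 'rV[R]_m) :
  dotv (a *: u) (b *: v) = a * b * dotv u v.
Proof. by rewrite /dotv mulr_sumr; apply: eq_bigr => i _; rewrite !mxE mulrACA. Qed.

Lemma wedgev_mulmx (n d : nat) (g : 'M[R]_d) (u : 'M[R]_(d, n)) :
  wedgev (g *m u) = \det g *: wedgev u.
Proof.
apply/rowP => k; rewrite !mxE -det_mulmx; congr (\det _).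
by apply/matrixP => i j; rewrite !mxE; apply: eq_bigr => l _; rewrite !mxE.
Qed.

(** Gram-Schmidt, from the last row upwards: the change of basis is block upper triangular with
    positive diagonal entries, so it preserves orientation. *)
Lemma row_free_orthonormalize {n d : nat} {u : 'M[R]_(d, n)} : row_free u ->
  exists2 g : 'M[R]_d, 0 < \det g & (g *m u) *m (g *m u)^T = 1%:M.
Proof.
elim: d u => [|d IH] u.
  by exists 1%:M; rewrite ?det1 ?ltr01//; apply/matrixP => -[].
rewrite -[d.+1]/(1 + d)%N in u * => uf.
pose u1 := usubmx u; pose u2 := dsubmx u.
(* A relation among the lower rows, padded with a zero, is a relation among all rows. *)
have uE : u = col_mx u1 u2 by rewrite vsubmxK.
have u2f : row_free u2.
  apply/inj_row_free => v v0.
  have : row_mx (0 : 'rV_1) v = 0.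
    apply: (row_free_inj uf).
    by rewrite mul0mx uE mul_row_col mul0mx add0r.
  by rewrite -row_mx0 => /eq_row_mx[].
have [g g0 gu] := IH _ u2f.
(* [v] is the first row minus its projection onto the span of the orthonormal rows [q]. *)
pose q := g *m u2; pose b := - (u1 *m q^T *m g).
pose v := u1 + b *m u2.
have vq : v *m q^T = 0.
  rewrite mulmxDl /b !mulNmx.
  have -> : u1 *m q^T *m g *m u2 *m q^T = u1 *m q^T *m (q *m q^T).
    by rewrite !mulmxA.
  by rewrite gu mulmx1 subrr.
have v0 : 0 < dotv v v.
  (* [v] is a combination of the free rows of [u] whose first coefficient is 1. *)
  rewrite lt_neqAle dotv_ge0 andbT eq_sym; apply/eqP => /dotv_eq0 v0.
  have : row_mx (1%:M : 'M[R]_1) b = 0.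
    by apply: (row_free_inj uf); rewrite mul0mx uE mul_row_col mul1mx.
  rewrite -row_mx0 => /eq_row_mx[/matrixP/(_ 0 0)].
  by rewrite !mxE eqxx => /eqP; rewrite oner_eq0.
pose c := (Num.sqrt (dotv v v))^-1.
have c0 : 0 < c by rewrite invr_gt0 sqrtr_gt0.
exists (block_mx c%:M (c *: b) 0 g).
  by rewrite det_ublock det_scalar expr1 mulr_gt0.
have -> : block_mx c%:M (c *: b) 0 g *m u = col_mx (c *: v) q.
  rewrite uE mul_block_col mul0mx add0r mul_scalar_mx /v scalerDr.
  by rewrite -scalemxAl.
rewrite tr_col_mx mul_col_row scalar_mx_block.
have -> : (c *: v) *m q^T = 0 by rewrite -scalemxAl vq scaler0.
have -> : q *m (c *: v)^T = 0 by rewrite -[LHS]trmxK trmx_mul trmxK -scalemxAl vq scaler0 trmx0.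
rewrite gu; congr block_mx.
apply/matrixP => i j; rewrite !ord1 -dotvE dotvZ !mxE eqxx.
by rewrite /c -invfM -expr2 sqr_sqrtr ?ltW// mulVf// gt_eqF.
Qed.

(** Orthonormalizing by [g] scales the wedge by [\det g > 0]. As the wedge of an orthonormal frame
    has norm 1, this factor must be the inverse of the norm of the original wedge. *)
Lemma oriented_grassmannianE (n d : nat) :
  @oriented_grassmannian R n d =
  @wedgev R n d @` [set u | u *m u^T = 1%:M].
Proof.
apply/seteqP; split => [xi [u uf ->]|_ [u uu <-]].
  have [g g0 gu] := row_free_orthonormalize uf.
  exists (g *m u) => //=; rewrite wedgev_mulmx.
  congr (_ *: _); have w0 := wedgev_neq0 uf.
  have := dotv_wedgev (g *m u) (g *m u).
  rewrite gu det1 wedgev_mulmx dotvZ -expr2 => h.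
  have wp : 0 < dotv (wedgev u) (wedgev u) by rewrite lt_neqAle eq_sym w0 dotv_ge0.
  apply/eqP; rewrite -(@eqrXn2 _ 2) ?invr_ge0 ?sqrtr_ge0 ?ltW//.
  by rewrite exprVn sqr_sqrtr ?ltW// -(mulIf w0 (etrans h (esym (mulVf w0)))).
have w1 : dotv (wedgev u) (wedgev u) = 1 by rewrite dotv_wedgev uu det1.
exists u; last by rewrite w1 sqrtr1 invr1 scale1r.
apply/row_freeP; by exists u^T.
Qed.

Lemma continuous_rV (X : topologicalType) (m : nat) (f : X -> 'rV[R]_m) :
  (forall j, continuous (fun x => f x 0 j)) -> continuous f.
Proof.
move=> fc x A [P Px PA]; rewrite nbhs_filterE /=.
have : \forall y \near x, forall j, P 0 j (f y 0 j).
  apply: filter_forall => j; exact: (fc j x _ (Px 0 j)).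
by apply: filterS => y Py; apply: PA => i j; rewrite ord1.
Qed.

Lemma continuous_det (X : topologicalType) (m : nat) (f : X -> 'M[R]_m) :
  (forall i j, continuous (fun x => f x i j)) -> continuous (fun x => \det (f x)).
Proof.
move=> fc; rewrite /determinant.
apply: continuous_big => [|s _]; first exact: add_continuous.
move=> x; apply: cvgMr; move: x.
by apply: continuous_big => [|i _]; [exact: mul_continuous | exact: fc].
Qed.

(** Frames are flattened to row vectors, where closed bounded sets are compact. The norm is the sup
    norm, and the square of an entry is at most the squared length of its row, which is 1. *)
Lemma compact_orthonormal_frames (n d : nat) :
  compact [set x : 'rV[R]_(d * n) | vec_mx x *m (vec_mx x)^T = 1%:M :> 'M[R]_d].
Proof.
apply: bounded_closed_compact.
  exists 1; split; first exact: num_real.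
  move=> M M1 x /= xx; rewrite [leLHS]/Num.norm /= mx_normrE.
  apply/bigmax_leP; split => [|[i j] _]; first exact: ltW (lt_trans _ M1).
  rewrite {}ord1 /=; apply: ltW; apply: le_lt_trans M1.
  case: (mxvec_indexP j) => a b.
  have /matrixP/(_ a a) := xx; rewrite !mxE eqxx mulr1n (bigD1 b)//= => xa.
  rewrite -(@ler_pXn2r _ 2) ?nnegrE// expr1n real_normK ?num_real//.
  have -> : x 0 (mxvec_index a b) = vec_mx x a b by rewrite mxE.
  rewrite -xa expr2 [(vec_mx x)^T b a]mxE lerDl; apply: sumr_ge0 => l _.
  by rewrite [X in _ * X]mxE -expr2 sqr_ge0.
pose f i j (x : 'rV[R]_(d * n)) := (vec_mx x *m (vec_mx x)^T) i j.
have -> : [set x : 'rV[R]_(d * n) | vec_mx x *m (vec_mx x)^T = 1%:M :> 'M[R]_d] =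
    \bigcap_(i in [set: 'I_d]) \bigcap_(j in [set: 'I_d])
      f i j @^-1` [set (1%:M : 'M[R]_d) i j].
  apply/seteqP; split => [x /= xx i _ j _|x xx] /=; first by rewrite /f xx.
  by apply/matrixP => i j; exact: xx.
apply: closed_bigI => i _; apply: closed_bigI => j _.
apply: closed_comp; last exact: closed_eq.
suff : continuous (f i j) by move=> fc x _; exact: fc.
have -> : f i j = (fun x => \sum_k x 0 (mxvec_index i k) * x 0 (mxvec_index j k)).
  by apply/funext => y; rewrite /f mxE; apply: eq_bigr => k _; rewrite !mxE.
apply: continuous_big => [|k _ x]; first exact: add_continuous.
by apply: continuousM; exact: coord_continuous.
Qed.

Lemma compact_oriented_grassmannian (n d : nat) :
  compact (@oriented_grassmannian R n d).
Proof.
have -> : @oriented_grassmannian R n d =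
    (fun x => wedgev (vec_mx x)) @`
      [set x : 'rV[R]_(d * n) | vec_mx x *m (vec_mx x)^T = 1%:M :> 'M[R]_d].
  rewrite oriented_grassmannianE; apply/seteqP; split => _ [u uu <-].
    by exists (mxvec u); rewrite /= mxvecK.
  by exists (vec_mx u).
apply: continuous_compact; last exact: compact_orthonormal_frames.
apply: continuous_subspaceT; apply: continuous_rV => k.
under eq_fun do rewrite mxE.
apply: continuous_det => i j.
under eq_fun do rewrite !mxE.
by move=> x; exact: coord_continuous.
Qed.

(** The topology is the one induced by [set_val]: a filter is pushed forward to multivectors, has a
    cluster point in the compact Grassmannian, and neighbourhoods of that point pull back. *)
Lemma compact_ograss (n d : nat) (hdn : (d <= n)%N) :
  compact [set: ograss R hdn].
Proof.
move=> F FF _.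
have PF : ProperFilter (set_val @ F : set_system (multivector R n d)).
  exact: fmap_proper_filter.
have FG : F [set T | @oriented_grassmannian R n d (set_val T)].
  by apply: filterE => T; exact: (set_mem (svalP T)).
have [xi [Gxi cl]] := compact_oriented_grassmannian n d _ PF FG.
exists (SigSub (mem_set Gxi)); split=> // A B FA.
move=> [_ [[U oU <-] Uxi UB]].
have Fim : F [set T | (set_val @` A) (set_val T)].
  by apply: filterS FA => T AT; exists T.
have [_ [[T AT <-] UT]] := cl _ U Fim (open_nbhs_nbhs (conj oU Uxi)).
by exists T; split => //; exact: UB.
Qed.

End grassmannian_compact.

(** * Integration against finite measures and finite sums of Dirac masses *)

Section discrete_varifolds.
Context {R : realType} {n d : nat} {hdn : (d <= n)%N}.
Local Notation Z := (varifold_base R hdn).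
Local Notation BZ := (borel_base R hdn).

Lemma continuous_borel_measurable (f : Z -> R) :
  continuous f -> measurable_fun [set: BZ] (f : BZ -> R).
Proof.
move=> fc; apply: (measurability _ (RGenOInfty.measurableE R)).
move=> _ [_ [a ->] <-]; rewrite setTI.
apply: sub_sigma_algebra.
by move/continuousP : fc; apply; rewrite set_itvE; exact: open_gt.
Qed.

Lemma continuous_bounded_integrable (m : {finite_measure set BZ -> \bar R})
    {f : Z -> R} {M : R} : continuous f -> (forall z, `|f z| <= M) ->
  m.-integrable [set: BZ] (EFin \o (f : BZ -> R)).
Proof.
move=> fc fM; apply: measurable_bounded_integrable => //.
- by rewrite ltey_eq fin_num_measure.
- exact: continuous_borel_measurable.
- exists M; split; first exact: num_real.
  by move=> y My z _; exact: le_trans (fM z) (ltW My).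
Qed.

Lemma Rintegral_norm_le (m : {finite_measure set BZ -> \bar R})
    {f : Z -> R} {M : R} : continuous f -> (forall z, `|f z| <= M) ->
  `|\int[m]_z (f : BZ -> R) z| <= M * fine (m setT).
Proof.
move=> fc fM; have fi := continuous_bounded_integrable m fc fM.
rewrite (le_trans (le_normr_Rintegral _ fi))//.
rewrite -Rintegral_cst//; apply: le_Rintegral => //.
- exact: integrable_norm.
- by apply: finite_measure_integrable_cst.
Qed.

Variables (N : nat) (r : 'I_N -> R) (x : 'I_N -> Z).
Hypothesis r0 : forall i, 0 <= r i.

(* [msum] sums an N-indexed family, so the ordinals are extended by the zero
   measure. *)
Let atom (j : nat) : {measure set BZ -> \bar R} :=
  if insub j is Some i then mscale (NngNum (r0 i)) \d_(x i : BZ) else mzero.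

Let atomE (i : 'I_N) : atom i = mscale (NngNum (r0 i)) \d_(x i : BZ).
Proof. by rewrite /atom valK. Qed.

Let msum_atomE A : msum atom N A = (\sum_(i < N) (r i)%:E * \d_(x i : BZ) A)%E.
Proof. by apply: eq_bigr => i _; rewrite atomE. Qed.

Let msum_atom_fin : fin_num_fun (msum atom N).
Proof.
move=> A mA; rewrite msum_atomE; apply/sum_fin_numP => i _ _.
by rewrite fin_numM// fin_num_measure.
Qed.

Lemma discrete_measure_exists :
  exists m : {finite_measure set BZ -> \bar R},
    forall A : set BZ, measurable A ->
      m A = (\sum_(i < N) (r i)%:E * \d_(x i : BZ) A)%E.
Proof.
pose mb := @Measure_isFinite.Build _ _ _ (msum atom N) msum_atom_fin.
pose m : {finite_measure set BZ -> \bar R} := HB.pack (msum atom N) mb.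
by exists m => A mA; rewrite -msum_atomE.
Qed.

Lemma Rintegral_discrete (m : {finite_measure set BZ -> \bar R}) {f : Z -> R}
    {M : R} :
  (forall A : set BZ, measurable A ->
    m A = (\sum_(i < N) (r i)%:E * \d_(x i : BZ) A)%E) ->
  continuous f -> (forall z, `|f z| <= M) ->
  \int[m]_z (f : BZ -> R) z = \sum_(i < N) r i * f (x i).
Proof.
move=> mE fc fM.
have mf : measurable_fun [set: BZ] (fun z => (f z)%:E).
  by apply/measurable_EFinP; exact: continuous_borel_measurable.
(* Integrals of nonnegative functions are additive in the measure; the positive and negative parts
   of [f] are treated separately and recombined as finite real sums. *)
have nonneg (g : BZ -> \bar R) : measurable_fun setT g -> (forall z, 0 <= g z)%E ->
    (\int[m]_z g z = \sum_(i < N) (r i)%:E * g (x i))%E.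
  move=> mg g0.
  rewrite (eq_measure_integral (msum atom N)); last first.
    by move=> A mA _; exact: etrans (mE _ mA) (esym (msum_atomE A)).
  rewrite ge0_integral_measure_sum//; apply: eq_bigr => i _.
  by rewrite atomE ge0_integral_mscale// integral_dirac// diracT mul1e.
rewrite /Rintegral integralE !nonneg//; first last.
- exact: measurable_funepos.
- exact: measurable_funeneg.
rewrite -/(EFin \o f) funerpos funerneg /=.
under eq_bigr do rewrite -EFinM.
under [X in (_ - X)%E]eq_bigr do rewrite -EFinM.
rewrite !sumEFin -EFinB /= -sumrB; apply: eq_bigr => i _.
by rewrite -mulrBr -[in RHS](funrposBneg f).
Qed.

End discrete_varifolds.

(** * Properties of the product kernel *)

Section varifold_kernel_theory.
Context {R : realType} {n d : nat} {hdn : (d <= n)%N} {rho gamma : R -> R}.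
Local Notation Z := (varifold_base R hdn).
Local Notation k := (@varifold_kernel R n d hdn rho gamma).

(** Both bounds come from expanding the squared norms of [s + t] and [s - t] for unit vectors. They
    place the argument of [gamma] where its sign is known. *)
Lemma ograss_dotv_itv (S T : ograss R hdn) :
  -1 <= dotv (set_val S) (set_val T) <= 1.
Proof.
set s := set_val S; set t := set_val T.
have ss : dotv s s = 1 by exact: ograss_unit.
have tt : dotv t t = 1 by exact: ograss_unit.
have sqr_dotv (e : R) : dotv (s + e *: t) (s + e *: t) =
    dotv s s + 2 * e * dotv s t + e ^+ 2 * dotv t t.
  rewrite /dotv !mulr_sumr -!big_split; apply: eq_bigr => i _ /=.
  by rewrite !mxE; ring.
have := dotv_ge0 (s + 1 *: t); have := dotv_ge0 (s + -1 *: t).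
by rewrite !sqr_dotv ss tt => ? ?; apply/andP; split; lra.
Qed.

Lemma varifold_kernel_diag (z : Z) : k z z = rho 0 * gamma 1.
Proof.
rewrite /varifold_kernel /kpos /kG subrr ograss_unit; congr (rho _ * _).
by rewrite /dotv big1// => i _; rewrite mxE mul0r.
Qed.

Lemma varifold_kernel_ge0 : (forall t, 0 <= t -> 0 <= rho t) ->
  (forall t, -1 <= t <= 1 -> 0 <= gamma t) -> forall z w : Z, 0 <= k z w.
Proof.
move=> r0 g0 z w; rewrite mulr_ge0//; first exact/r0/dotv_ge0.
exact/g0/ograss_dotv_itv.
Qed.

(** Only the position can go to infinity: compactness of the Grassmannian bounds the second factor
    and makes [K] times the whole Grassmannian compact. *)
Lemma varifold_kernel_C0 :
  (forall x : 'rV[R]_n, C0 (@kpos R n rho x)) ->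
  continuous_kernel (@kG R n d hdn gamma) ->
  (forall z : Z, C0 (k z)).
Proof.
move=> pC0 Gc [x S]; have [pc p0] := pC0 x.
have GSc : continuous (@kG R n d hdn gamma S).
  move=> T A /(Gc (S, T) A)[[P Q] [/= PS QT] PQ].
  apply: filterS QT => T' QT'; apply: (PQ (S, T')); split => //.
  exact: nbhs_singleton PS.
split.
  move=> [y T]; apply: cvgM.
    by apply: (@continuous_comp _ _ _ fst (kpos rho x)); [exact: cvg_fst|exact: pc].
  by apply: (@continuous_comp _ _ _ snd (kG gamma S)); [exact: cvg_snd|exact: GSc].
have [M M0 GM] : exists2 M, 0 < M & forall T, `|kG gamma S T| <= M.
  have cG : compact (@kG R n d hdn gamma S @` setT).
    apply: continuous_compact; last exact: compact_ograss.
    exact: continuous_subspaceT.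
  have /ex_strict_bound_gt0[M M0 GM] := compact_bounded cG.
  by exists M => // T; apply/ltW/GM; exists T.
move=> e e0; have [K cK Ke] := p0 _ (divr_gt0 e0 M0).
exists (K `*` setT).
  by apply: compact_setX => //; exact: compact_ograss.
move=> [y T] /= nKT.
have Ky : ~ K y by move=> Ky; apply: nKT.
rewrite /varifold_kernel /= normrM.
(* The strict inequality survives multiplication only by a nonzero factor. *)
have [->|G0] := eqVneq (kG gamma S T) 0; first by rewrite normr0 mulr0.
apply: (@lt_le_trans _ _ (e / M * `|kG gamma S T|)).
  by rewrite ltr_pM2r ?normr_gt0// Ke.
by rewrite mulrAC ler_pdivrMr// ler_wpM2l// ltW.
Qed.

End varifold_kernel_theory.

(** * From configurations to varifolds *)

Theorem proposition5p3 (R : realType) (n d : nat) (hdn : (d <= n)%N)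
    (rho gamma : R -> R)
    (rho_cont : {within `[0, +oo[, continuous rho})
    (gamma_cont : {within `[-1, 1], continuous gamma})
    (kpos_cont : continuous_kernel (@kpos R n rho))
    (kpos_pd : positive_definite_kernel (@kpos R n rho))
    (kG_cont : continuous_kernel (@kG R n d hdn gamma))
    (kG_pd : positive_definite_kernel (@kG R n d hdn gamma))
    (rho0 : 0 < rho 0)
    (kpos_C0 : forall x : 'rV[R]_n, C0 (@kpos R n rho x))
    (rho_ge0 : forall t : R, 0 <= t -> 0 <= rho t)
    (gamma_ge0 : forall t : R, -1 <= t <= 1 -> 0 <= gamma t)
    (W : rkhs (@varifold_kernel R n d hdn rho gamma))
    (mu : {finite_measure set (borel_base R hdn) -> \bar R}) (N : nat) :
  varifold mu -> (1 <= N)%N ->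
  exists2 mu_N : {finite_measure set (borel_base R hdn) -> \bar R},
    discrete_varifold N mu_N &
    forall nu : {finite_measure set (borel_base R hdn) -> \bar R},
      discrete_varifold N nu ->
      (dual_norm (fun w : W => (pairing mu_N w - pairing mu w)%R) <=
       dual_norm (fun w : W => (pairing nu w - pairing mu w)%R))%E.
Proof.
move=> _ _.
set C := rho 0 * gamma 1.
have kC (z : varifold_base R hdn) : varifold_kernel rho gamma z z = C.
  exact: varifold_kernel_diag.
have kC0 := varifold_kernel_C0 kpos_C0 kG_cont.
have w_cont (w : W) := rkhs_fun_continuous W _ kC kC0 w.
have w_le (w : W) z : `|rkhs_fun W w z| <= `|w| * Num.sqrt C.
  by rewrite -(kC z) rkhs_fun_le.
(* This supplies the constant [B]: the sup bound [Num.sqrt C] on the unit ball times the total mass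
   of [mu]. *)
have pairing_le (w : W) : `|w| <= 1 ->
    `|pairing mu w| <= Num.sqrt C * fine (mu setT).
  move=> w1; apply: Rintegral_norm_le => [|z]; first exact: w_cont.
  by rewrite (le_trans (w_le w z))// ler_piMl// sqrtr_ge0.
(* Both the minimizer and every competitor thereby become weighted sums of evaluations, the form
   compared in [best_approximation]. *)
have pairingE (nu : {finite_measure set (borel_base R hdn) -> \bar R}) r x T :
    (forall i : 'I_N, 0 <= r i) ->
    (forall A : set (borel_base R hdn), measurable A ->
      nu A = (\sum_(i < N) (r i)%:E * \d_((x i, T i) : borel_base R hdn) A)%E) ->
    forall w : W, pairing nu w = \sum_(i < N) r i * rkhs_fun W w (x i, T i).
  move=> r0 nuE w.
  exact: (Rintegral_discrete N r (fun i => (x i, T i)) r0 _ nuE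
    (w_cont w) (w_le w)).
have [r [z [r0 best]]] : exists (r : 'I_N -> R) (z : 'I_N -> varifold_base R hdn),
    (forall i, 0 <= r i) /\
    forall r' z', (forall i, 0 <= r' i) ->
    (dual_norm (fun w : W =>
       (\sum_(i < N) r i * rkhs_fun W w (z i) - pairing mu w)%R) <=
     dual_norm (fun w : W =>
       (\sum_(i < N) r' i * rkhs_fun W w (z' i) - pairing mu w)%R))%E.
  (* The weight bound divides by [Num.sqrt C], so vanishing [C] is treated apart. *)
  have : 0 <= C by rewrite mulr_ge0 ?(ltW rho0)// gamma_ge0// lexx andbT; lra.
  rewrite le_eqVlt => /predU1P[C0|C0]; last first.
    apply: (best_approximation W point _ _ _ N C0 kC _ kC0 pairing_le).
    exact: varifold_kernel_ge0.
  (* Here gamma 1 = 0 and W is the zero space. *)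
  exists (cst 0), (cst point); split=> // r' z' _.
  have w0 (w : W) y : rkhs_fun W w y = 0.
    by apply/eqP; rewrite -normr_le0 (le_trans (w_le w y))// -C0 sqrtr0 mulr0.
  by under eq_fun do under eq_bigr do rewrite w0 mulr0;
    under [X in (_ <= dual_norm X)%E]eq_fun do under eq_bigr do rewrite w0 mulr0.
have [m mE] := discrete_measure_exists N r z r0.
have mE' A : measurable A -> m A =
    (\sum_(i < N) (r i)%:E * \d_(((z i).1, (z i).2) : borel_base R hdn) A)%E.
  by move=> mA; rewrite mE//; apply: eq_bigr => i _; rewrite -surjective_pairing.
exists m; first by exists r, (fun i => (z i).1), (fun i => (z i).2).
move=> nu [r' [x' [T' [r'0 nuE]]]].
have -> : (fun w : W => (pairing m w - pairing mu w)%R) =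
    fun w => \sum_(i < N) r i * rkhs_fun W w (z i) - pairing mu w.
  apply/funext => w; rewrite (pairingE _ _ _ _ r0 mE').
  by congr (_ - _); apply: eq_bigr => i _; rewrite -surjective_pairing.
have -> : (fun w : W => (pairing nu w - pairing mu w)%R) =
    fun w => \sum_(i < N) r' i * rkhs_fun W w (x' i, T' i) - pairing mu w.
  by apply/funext => w; rewrite (pairingE _ _ _ _ r'0 nuE).
exact: (best r' (fun i => (x' i, T' i))).
Qed.
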